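(* Let $p$ be a prime and $D_{2p}$ the dihedral group of order $2p$. Then $D_{2p}$ is Cay-DS if and only if $p\in\{2,3,5,7,11\}$. Moreover, for every prime $p\geq 13$ there exist two cospectral non-isomorphic $6$-regular Cayley graphs on $D_{2p}$.
   Context: For a finite group $G$ and a subset $S\subseteq G\setminus\{1\}$ with $S=S^{-1}$, the Cayley graph $Cay(G,S)$ has vertex set $G$, with $a,b$ adjacent iff $ab^{-1}\in S$. The spectrum of a graph is the multiset of eigenvalues of its adjacency matrix; graphs with equal spectra are cospectral. A finite group $G$ is Cay-DS if every Cayley graph $\Gamma$ on $G$ is isomorphic to every Cayley graph $\Gamma'$ (on any finite group) cospectral with $\Gamma$. *)

(* Defs.v *)
From mathcomp Require Import all_boot all_order all_fingroup all_algebra.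
From mathcomp Require Import all_solvable all_field.
Set Implicit Arguments.
Unset Strict Implicit.
Unset Printing Implicit Defensive.
Import GRing.Theory.
Local Open Scope ring_scope.

Definition adj_mx (T : finType) (e : rel T) : 'M[algC]_#|T| :=
  \matrix_(i, j) (e (enum_val i) (enum_val j))%:R.

(* Eigenvalues listed with algebraic multiplicity, meaningful only up to
   perm_eq: char_poly A is monic, hence equal to the product of the ('X - x%:P)
   for x in this sequence. *)
Definition spectrum n (A : 'M[algC]_n) : seq algC :=
  sval (closed_field_poly_normal (char_poly A)).

Definition cospectral (T U : finType) (e : rel T) (f : rel U) : Prop :=
  perm_eq (spectrum (adj_mx e)) (spectrum (adj_mx f)).

Definition graph_isom (T U : finType) (e : rel T) (f : rel U) : Prop :=
  exists2 h : T -> U, bijective h & forall x y, f (h x) (h y) = e x y.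

Definition regular_graph (k : nat) (T : finType) (e : rel T) : Prop :=
  forall x, #|[set y | e x y]| = k.

Local Open Scope group_scope.

(* Groups are whole finGroupTypes; a subgroup G : {group gT} is covered as the
   finGroupType [subg G]. *)

Definition connection_set (gT : finGroupType) (S : {set gT}) : Prop :=
  1 \notin S /\ S^-1 = S.

Definition Cay (gT : finGroupType) (S : {set gT}) : rel gT :=
  fun a b => a * b^-1 \in S.

Definition Cay_DS (gT : finGroupType) : Prop :=
  forall S : {set gT}, connection_set S ->
  forall (hT : finGroupType) (S' : {set hT}), connection_set S' ->
  cospectral (Cay S) (Cay S') -> graph_isom (Cay S) (Cay S').

(* Main.v *)
From Stdlib Require BinNat Nnat.
Require Import Defs.
From mathcomp Require Import all_boot all_order all_fingroup all_algebra.
From mathcomp Require Import all_solvable all_field.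
Set Implicit Arguments.
Unset Strict Implicit.
Unset Printing Implicit Defensive.
Import GRing.Theory Num.Theory.

(* A Cayley graph on a group of order 2p is a bicirculant graph on two copies of
   Z/p, given by a symmetric set A (edges inside a copy) and an arbitrary set B
   (edges between the copies). Symmetric graphs are cospectral iff they have the
   same number of closed walks of every length.

   For p >= 13 the integer sets {0,1,2,6,8,11} and {0,1,6,7,9,11} have the same
   multiset of differences, so with A empty they give adjacency matrices with the
   same square, hence cospectral bipartite graphs; these are told apart by a
   weighted count of triples of neighbours of a vertex (p = 19 needs another
   pair).

   For p = 3, 5, 7, 11 affine maps of Z/p leave finitely many pairs (A, B) in
   normal form, and a computation shows that closed walks of lengths 2, 5, 6, 10
   and 11 separate them up to affine equivalence. For p = 2 the degree suffices. *)

(** * Cospectrality and closed walks *)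

Section ClosedWalks.
Local Open Scope ring_scope.

(** Equal power sums give equal sums of every polynomial over [s] and [t]. A polynomial vanishing at
    every entry other than [a] then compares the multiplicities of [a], since characteristic 0
    allows cancelling its value at [a]. *)
Lemma power_sums_perm_eq (F : numFieldType) (s t : seq F) :
  (forall k, \sum_(x <- s) x ^+ k = \sum_(x <- t) x ^+ k) -> perm_eq s t.
Proof.
move=> eq_pow; apply/allP => a _ /=; apply/eqP.
have eq_horner (q : {poly F}) : \sum_(x <- s) q.[x] = \sum_(x <- t) q.[x].
  have expand r : \sum_(x <- r) q.[x] = \sum_(i < size q) q`_i * \sum_(x <- r) x ^+ i.
    rewrite (eq_bigr (fun x => \sum_(i < size q) q`_i * x ^+ i)).
      by rewrite exchange_big; apply: eq_bigr => i _; rewrite mulr_sumr.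
    by move=> x _; rewrite horner_coef.
  by rewrite !expand; apply: eq_bigr => i _; rewrite eq_pow.
pose l := [seq x <- undup (s ++ t) | x != a].
pose q := \prod_(y <- l) ('X - y%:P).
have qx x : x \in s ++ t -> x != a -> q.[x] = 0.
  move=> xst xa; apply/eqP; rewrite -[_ == 0]/(root q x) root_prod_XsubC.
  by rewrite mem_filter xa mem_undup.
have qa : q.[a] != 0.
  by rewrite -[_ == 0]/(root q a) root_prod_XsubC mem_filter eqxx.
have count_sum r : {subset r <= s ++ t} ->
    \sum_(x <- r) q.[x] = q.[a] *+ count_mem a r.
  elim: r => [|x r IHr] sub_r; first by rewrite big_nil.
  rewrite big_cons IHr /=; last by move=> y ry; rewrite sub_r ?inE ?ry ?orbT.
  have [->|xa] := eqVneq x a; first by rewrite mulrS.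
  by rewrite qx ?add0r ?add0n // sub_r ?mem_head.
have := eq_horner q; rewrite !count_sum.
- by move/(mulrIn qa).
- by move=> x xt; rewrite mem_cat xt orbT.
- by move=> x xs; rewrite mem_cat xs.
Qed.

Fixpoint walks (T : finType) (e : rel T) (k : nat) (x y : T) : nat :=
  if k is k'.+1 then (\sum_z walks e k' x z * e z y)%N else (x == y).

Definition closed_walks (T : finType) (e : rel T) (k : nat) : nat :=
  (\sum_x walks e k x x)%N.

Lemma adj_mxX (T : finType) (e : rel T) k i j :
  (adj_mx e ^+ k) i j = (walks e k (enum_val i) (enum_val j))%:R.
Proof.
elim: k j => [|k IHk] j.
  by rewrite expr0 mxE /= (inj_eq enum_val_inj).
rewrite exprSr mxE /= natr_sum (reindex _ (onW_bij _ (enum_val_bij T))) /=.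
by apply: eq_bigr => l _; rewrite IHk mxE natrM.
Qed.

Lemma adj_mx_trX (T : finType) (e : rel T) k :
  \tr (adj_mx e ^+ k) = (closed_walks e k)%:R.
Proof.
rewrite /closed_walks natr_sum /mxtrace.
rewrite (reindex _ (onW_bij _ (enum_val_bij T))) /=.
by apply: eq_bigr => i _; rewrite adj_mxX.
Qed.

Lemma spectrumE n (A : 'M[algC]_n) :
  char_poly A = \prod_(z <- spectrum A) ('X - z%:P).
Proof.
rewrite /spectrum; case: closed_field_poly_normal => r /= ->.
have /eqP := char_poly_monic A; rewrite -[X in X = 1]/(lead_coef _) => ->.
by rewrite scale1r.
Qed.

Lemma mulmx_conj_expr n (P A : 'M[algC]_n) k : P \in unitmx ->
  (invmx P *m A *m P) ^+ k = invmx P *m A ^+ k *m P.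
Proof.
move=> uP; elim: k => [|k IHk]; first by rewrite !expr0 mulmx1 mulVmx.
by rewrite !exprS IHk -!mulmxE !mulmxA mulmxK.
Qed.

Lemma char_poly_conj n (P A : 'M[algC]_n) : P \in unitmx ->
  char_poly (invmx P *m A *m P) = char_poly A.
Proof.
move=> uP; rewrite /char_poly /char_poly_mx !map_mxM map_invmx.
have uP' : map_mx (@polyC algC) P \in unitmx by rewrite map_unitmx.
set P' := map_mx _ P; set A' := map_mx _ A.
have -> : 'X%:M - invmx P' *m A' *m P' = invmx P' *m ('X%:M - A') *m P'.
  by rewrite mulmxBr mulmxBl scalar_mxC -(mulmxA _ (invmx P')) mulVmx // mulmx1.
rewrite !det_mulmx mulrAC -det_mulmx mulVmx // det1 mul1r //.
Qed.

(** A real symmetric matrix is normal, so the spectral theorem makes it similar to a diagonal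
    matrix; the traces of powers are then the power sums of the eigenvalues. *)
Lemma spectrum_trX (T : finType) (e : rel T) k : symmetric e ->
  \sum_(z <- spectrum (adj_mx e)) z ^+ k = (closed_walks e k)%:R.
Proof.
move=> sym_e; rewrite -adj_mx_trX; set A := adj_mx e.
have nA : A \is normalmx.
  apply: symmetric_normalmx.
    by apply/is_hermitianmxP/matrixP => i j; rewrite !mxE expr0 mul1r sym_e.
  by apply/mxOverP => i j; rewrite mxE realn.
have uP : spectralmx A \in unitmx.
  by rewrite unitarymx_unit ?spectral_unitarymx.
have defA := orthomx_spectralP nA.
set P := spectralmx A in uP defA; set d := spectral_diag A in defA.
have trig_d : is_trig_mx (diag_mx d) by rewrite diag_mx_is_trig.
have eq_spec : perm_eq (spectrum A) [seq d 0 i | i <- enum 'I_#|T|].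
  apply: prod_XsubC_eq; rewrite -spectrumE {1}defA char_poly_conj //.
  rewrite char_poly_trig // big_map big_enum.
  by apply: eq_bigr => i _; rewrite mxE eqxx.
rewrite (perm_big _ eq_spec) big_map big_enum /= {1}defA mulmx_conj_expr //.
rewrite mxtrace_mulC mulmxA mulmxV // mul1mx.
have -> : diag_mx d ^+ k = diag_mx (\row_i d 0 i ^+ k).
  elim: k => [|k IHk].
    rewrite expr0; apply/matrixP=> i j; rewrite !mxE expr0 //.
  rewrite exprS IHk -mulmxE mulmx_diag; congr diag_mx.
  by apply/rowP => i; rewrite !mxE exprS.
by rewrite mxtrace_diag; apply: eq_bigr => i _; rewrite mxE.
Qed.

Lemma cospectralP (T U : finType) (e : rel T) (f : rel U) :
    symmetric e -> symmetric f ->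
  cospectral e f <-> (forall k, closed_walks e k = closed_walks f k).
Proof.
move=> sym_e sym_f; split=> [|eq_ef].
  move=> eq_spec k; apply/eqP; rewrite -(eqr_nat algC) -!spectrum_trX //.
  by rewrite (perm_big _ eq_spec).
by apply: power_sums_perm_eq => k; rewrite !spectrum_trX // eq_ef.
Qed.

End ClosedWalks.

(** * Isomorphism and bicirculant graphs *)

Section Isomorphism.

Lemma graph_isom_sym (T U : finType) (e : rel T) (f : rel U) :
  graph_isom e f -> graph_isom f e.
Proof.
case=> h [g hK gK] fe; exists g; first by exists h.
by move=> x y; rewrite -fe !gK.
Qed.

Lemma graph_isom_trans (T U V : finType) (e : rel T) (f : rel U) (g : rel V) :
  graph_isom e f -> graph_isom f g -> graph_isom e g.
Proof.
case=> h bij_h fe [h' bij_h' gf]; exists (h' \o h); first exact: bij_comp.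
by move=> x y /=; rewrite gf fe.
Qed.

Lemma eq_graph_isom (T : finType) (e f : rel T) : e =2 f -> graph_isom e f.
Proof. by move=> ef; exists id => // ; exists id. Qed.

Section Invariants.

Variables (T U : finType) (e : rel T) (f : rel U) (h : T -> U).
Hypotheses (bij_h : bijective h) (fh : forall x y, f (h x) (h y) = e x y).

Lemma walks_isom k x y : walks f k (h x) (h y) = walks e k x y.
Proof.
elim: k y => [|k IHk] y /=; first by rewrite (bij_eq bij_h).
rewrite (reindex h (onW_bij _ bij_h)).
by apply: eq_bigr => z _; rewrite IHk fh.
Qed.

Lemma closed_walks_isom k : closed_walks f k = closed_walks e k.
Proof.
rewrite /closed_walks (reindex h (onW_bij _ bij_h)).
by apply: eq_bigr => x _; rewrite walks_isom.
Qed.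

End Invariants.

(** Lets cospectrality of Cayley graphs be tested on their bicirculant models. *)
Lemma cospectral_isom (T U T' U' : finType)
    (e : rel T) (f : rel U) (e' : rel T') (f' : rel U') :
    symmetric e -> symmetric f -> symmetric e' -> symmetric f' ->
    graph_isom e e' -> graph_isom f f' ->
  cospectral e f <-> (forall k, closed_walks e' k = closed_walks f' k).
Proof.
move=> sym_e sym_f sym_e' sym_f' [h bij_h eh] [g bij_g fg].
have [cosp_walks walks_cosp] := cospectralP sym_e sym_f.
split=> [cosp k | eq_cl].
  by rewrite (closed_walks_isom bij_h eh) (closed_walks_isom bij_g fg) cosp_walks.
apply: walks_cosp => k.
by rewrite -(closed_walks_isom bij_h eh) -(closed_walks_isom bij_g fg).
Qed.

(** Cut the walk after [i] steps. This later gives closed walks of length 11 from walks of lengths 5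
    and 6. *)
Lemma walksD (T : finType) (e : rel T) i j x y :
  walks e (i + j) x y = \sum_z walks e i x z * walks e j z y.
Proof.
elim: j y => [|j IHj] y.
  rewrite addn0 (bigD1 y) //= eqxx muln1 big1 ?addn0 // => z /negPf.
  by rewrite eq_sym => ->; rewrite muln0.
rewrite addnS /=; under eq_bigr => z _ do rewrite IHj big_distrl /=.
rewrite exchange_big /=; apply: eq_bigr => z _.
by rewrite big_distrr /=; apply: eq_bigr => t _; rewrite mulnA.
Qed.

Lemma walks1 (T : finType) (e : rel T) x y : walks e 1 x y = e x y.
Proof.
rewrite /= (bigD1 x) //= eqxx mul1n big1 ?addn0 // => z /negPf.
by rewrite eq_sym => ->.
Qed.

Lemma walks_sym (T : finType) (e : rel T) k x y : symmetric e ->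
  walks e k x y = walks e k y x.
Proof.
move=> sym_e; elim: k x y => [|k IHk] x y; first by rewrite /= eq_sym.
rewrite -{2}add1n walksD; apply: eq_bigr => z _.
by rewrite walks1 sym_e IHk mulnC.
Qed.

Lemma Cay_sym (gT : finGroupType) (S : {set gT}) :
  connection_set S -> symmetric (Cay S).
Proof.
by case=> _ SV x y; rewrite /Cay -[in LHS]SV inE invMg invgK.
Qed.

End Isomorphism.

(** * Bicirculant graphs: vertex-transitivity and affine maps *)

Section Bicirculant.

Variable n : nat.
Local Notation p := n.+2.
Local Open Scope ring_scope.

(* The Cayley graph with rotation part A and reflection part B. The vertices
   (x, false) carry the labelling that makes the cross edges depend on a
   difference, both for the dihedral and for the cyclic group. *)
Definition bicirculant (A B : pred 'I_p) : rel ('I_p * bool) :=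
  fun u v => if u.2 == v.2 then A (u.1 - v.1)
             else if u.2 then B (u.1 - v.1) else B (v.1 - u.1).

Definition circulant_set (A : pred 'I_p) : Prop :=
  A 0 = false /\ forall x, A (- x) = A x.

Lemma bicirculant_sym A B : circulant_set A -> symmetric (bicirculant A B).
Proof.
case=> _ AN [x []] [y []]; rewrite /bicirculant //=;
  by rewrite -AN opprB.
Qed.

Lemma eq_bicirculant A B A' B' :
  A =1 A' -> B =1 B' -> bicirculant A B =2 bicirculant A' B'.
Proof. by move=> eqA eqB u v; rewrite /bicirculant eqA !eqB. Qed.

(** A translation by [c] moves [(0, false)] within its copy. To change copies a negation is added:
    it preserves the symmetric set [A] and reverses the differences on cross edges, as exchanging
    the copies does. *)
Lemma bicirculant_transitive A B v : circulant_set A ->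
  exists2 h : 'I_p * bool -> 'I_p * bool, bijective h
    & h (0, false) = v
      /\ forall x y, bicirculant A B (h x) (h y) = bicirculant A B x y.
Proof.
case=> _ AN; case: v => c e.
pose s (x : 'I_p) := if e then - x else x.
have sK : involutive s by rewrite /s => x; case: (e); rewrite ?opprK.
pose h (u : 'I_p * bool) := (s u.1 + c, u.2 (+) e).
exists h.
  exists (fun u => (s (u.1 - c), u.2 (+) e)) => [] [x d] /=;
    by rewrite /h /= ?addrK ?sK ?subrK -addbA addbb addbF.
split=> [|[x d] [y d']].
  by rewrite /h /= /s; case: (e); rewrite ?oppr0 add0r.
have sB (a b : 'I_p) : s a + c - (s b + c) = s (a - b).
  by rewrite opprD addrACA subrr addr0 /s; case: (e); rewrite ?opprB ?opprK // addrC.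
rewrite /h /bicirculant /= !sB /s.
by case: (e); case: d; case: d'; rewrite //= ?AN ?opprB.
Qed.

Lemma bicirculant_closed_walks A B k : circulant_set A ->
  closed_walks (bicirculant A B) k
  = (p.*2 * walks (bicirculant A B) k (0%R, false) (0%R, false))%N.
Proof.
move=> cA; rewrite /closed_walks.
rewrite (eq_bigr (fun=> walks (bicirculant A B) k (0, false) (0, false))).
  by rewrite sum_nat_const card_prod card_ord card_bool muln2.
move=> v _; have [h bij_h [<- hh]] := bicirculant_transitive B v cA.
exact: (walks_isom bij_h hh).
Qed.

(** The multiplier acts on both copies, but only the copy [true] is translated, which shifts [B] and
    leaves [A] alone. *)
Lemma bicirculant_affine A B (c d : 'I_p) : injective ( *%R c) ->
  graph_isom (bicirculant (fun x => A (c * x)) (fun x => B (c * x + d)))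
             (bicirculant A B).
Proof.
move=> inj_c.
exists (fun u : 'I_p * bool => (c * u.1 + (if u.2 then d else 0), u.2)).
  apply: injF_bij => [] [x e] [y e'] eq_h.
  have eq_e : e = e' := congr1 snd eq_h.
  have : c * x + (if e then d else 0) = c * y + (if e' then d else 0) :=
    congr1 fst eq_h.
  by rewrite eq_e => /addIr/inj_c->.
move=> [x e] [y e']; rewrite /bicirculant.
case: e; case: e' => /=.
- by rewrite opprD addrACA subrr addr0 mulrBr.
- by rewrite addr0 mulrBr addrAC.
- by rewrite addr0 mulrBr addrAC.
- by rewrite !addr0 mulrBr.
Qed.

End Bicirculant.

(** * Cayley graphs on groups of order 2p *)

Section Groups.

Local Open Scope group_scope.

Section TwoGenerators.

Variables (gT : finGroupType) (n : nat) (a a' b : gT).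
Local Notation p := n.+2.
Hypotheses (oa : #[a] = p) (a'P : a' = a \/ a' = a^-1).
Hypotheses (ba' : b * a' = a * b) (bNa : b \notin <[a]>).
Hypothesis oG : #|gT| = p.*2.

Lemma expg_ordB (c : gT) (x y : 'I_p) : #[c] = p ->
  c ^+ (x - y)%R = c ^+ x * (c ^+ y)^-1.
Proof.
move=> oc; apply: (mulIg (c ^+ y)); rewrite mulgKV -expgD.
have e : ((x - y)%R + y) %% #[c] = x by rewrite oc; apply: (congr1 val (subrK y x)).
by rewrite -[in RHS]e expg_mod_order.
Qed.

Let oa' : #[a'] = p. Proof. by case: a'P => ->; rewrite ?orderV. Qed.

Let bX k : b * (a' ^+ k)^-1 = (a ^+ k)^-1 * b.
Proof.
apply: (mulgI (a ^+ k)); apply: (mulIg (a' ^+ k)).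
rewrite mulgA mulgKV mulKVg; elim: k => [|k IHk]; first by rewrite mulg1 mul1g.
by rewrite [in LHS]expgSr -mulgA -ba' mulgA IHk -mulgA -expgSr.
Qed.

Definition rot_part (S : {set gT}) : pred 'I_p := fun x => a ^+ x \in S.
Definition refl_part (S : {set gT}) : pred 'I_p := fun x => a ^+ x * b \in S.

Lemma rot_part_circulant S : connection_set S -> circulant_set (rot_part S).
Proof.
case=> S1 SV; split=> [|x]; first by rewrite /rot_part expg0; apply: negPf.
by rewrite /rot_part -[in LHS]SV inE -sub0r expg_ordB // mul1g invgK.
Qed.

(** The copy [false] is labelled by powers of [a'], the conjugate of [a] by [b]. Moving [b] past
    them turns them into powers of [a], so cross edges depend on a difference whether [b]
    centralises or inverts [a]. *)
Lemma Cay_bicirculant S : connection_set S ->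
  graph_isom (bicirculant (rot_part S) (refl_part S)) (Cay S).
Proof.
move=> conS; have [S1 SV] := conS.
pose h (u : 'I_p * bool) := if u.2 then a ^+ u.1 * b else a' ^+ u.1.
have expI (c : gT) : #[c] = p -> injective (fun x : 'I_p => c ^+ x).
  move=> oc x y /= /eqP; rewrite eq_expg_mod_order oc !modn_small //.
  by move/eqP/val_inj.
have a'a k : a' ^+ k \in <[a]>.
  by case: a'P => ->; rewrite groupX ?groupV ?cycle_id.
have aNb k : a ^+ k * b \notin <[a]> by rewrite groupMl ?mem_cycle.
exists h.
  apply: inj_card_bij; last by rewrite oG card_prod card_ord card_bool muln2.
  move=> [x []] [y []]; rewrite /h /=.
  - by move/mulIg/(expI _ oa) ->.
  - by move=> eq_h; have := aNb x; rewrite eq_h a'a.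
  - by move=> eq_h; have := aNb y; rewrite -eq_h a'a.
  - by move/(expI _ oa') ->.
have cross (x y : 'I_p) : (h (y, true) * (h (x, false))^-1 \in S)
    = refl_part S (y - x)%R.
  by rewrite /h /= -mulgA bX mulgA /refl_part expg_ordB.
move=> [x []] [y []]; rewrite /Cay /bicirculant [RHS]/=.
- by rewrite /h /= invMg mulgA mulgK /rot_part expg_ordB.
- exact: cross.
- by rewrite -cross -[in LHS]SV inE invMg invgK.
(* Inside the copy [false] quotients are powers of [a']; if [a'] is the inverse of [a], closure of
   [S] under inversion replaces them by powers of [a]. *)
- rewrite /h /= -(expg_ordB _ _ oa') /rot_part; case: a'P => -> //.
  by rewrite expVgn -[in LHS]SV inE invgK.
Qed.

End TwoGenerators.

(** Take [a] of order p by Cauchy; the subgroup it generates has index 2, so it is normal and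
    contains the square of any [b] outside it. Hence conjugation by [b] fixes [c], the product of
    [a] and its conjugate. Either [c] is trivial and [b] inverts [a], or [c] generates the subgroup
    and [b] centralises it. *)
Lemma order_2p_generators (gT : finGroupType) (p : nat) :
    prime p -> #|gT| = p.*2 ->
  exists a a' b : gT, [/\ #[a] = p, a' = a \/ a' = a^-1, b * a' = a * b
    & b \notin <[a]>].
Proof.
move=> p_pr oG; have oGT : #|[set: gT]| = p.*2 by rewrite cardsT.
have p_dv : p %| #|[set: gT]| by rewrite oGT -mul2n dvdn_mull.
have [a _ oa] := Cauchy p_pr p_dv.
pose H := <[a]>%G; have oH : #|H| = p by [].
have iH : #|[set: gT] : H| = 2.
  by rewrite -divgS ?subsetT // oGT oH -mul2n mulnK ?prime_gt0.
have nH : H <| [set: gT] by apply: index2_normal; rewrite ?subsetT.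
have [b bH] : exists b, b \notin H.
  apply/existsP; rewrite -negb_forall; apply/negP => /forallP allH.
  have /subset_leq_card : [set: gT] \subset H by apply/subsetP => x _; apply: allH.
  by rewrite oGT oH -addnn -{3}[p]addn0 leq_add2l leqNgt prime_gt0.
have nHb : b \in 'N(H) by apply: (subsetP (normal_norm nH)); rewrite inE.
have bbH : b * b \in H.
  rewrite -[_ * _]/(b ^+ 2); apply: coset_idr; first exact: groupX.
  have oq : #|[set: gT] / H| = 2 by rewrite card_quotient ?normal_norm.
  rewrite morphX // -oq; apply: expg_cardG.
  by apply: mem_quotient; rewrite inE.
have cHH : abelian H := cycle_abelian a.
have aH : a \in H := cycle_id a.
have abH : a ^ b \in H by rewrite memJ_norm.
exists a, (a ^ b), b; split=> //; last by rewrite -conjgC.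
have cH x y : x \in H -> y \in H -> x ^ y = x.
  by move=> xH yH; rewrite conjgE (centsP cHH x xH y yH) mulKg.
pose c := a * a ^ b.
have cH' : c \in H by rewrite groupM.
have cb : c ^ b = c.
  by rewrite conjMg -conjgM (cH a (b * b)) // (centsP cHH _ abH a aH).
have [c1|cn1] := eqVneq c 1.
  by right; apply: (mulgI a); rewrite mulgV.
left.
have oc : #[c] = p.
  have : #[c] %| p by rewrite -oH order_dvdG.
  by move: p_pr => /primeP[_ dv] /dv; rewrite order_eq1 (negPf cn1) => /eqP.
have /cycleP[k ->] : a \in <[c]>.
  have <- // : H :=: <[c]>.
  by apply/esym/eqP; rewrite eqEcard cycle_subG cH' oH -orderE oc leqnn.
by rewrite conjXg cb.
Qed.

End Groups.

(** * Counting walks by computation *)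

Section WalkVectors.

Import BinNums.

(** Entries are binary naturals because the counts are evaluated inside the kernel. *)
Fixpoint addv (u v : seq N) : seq N :=
  match u, v with
  | x :: u', y :: v' => BinNat.N.add x y :: addv u' v'
  | _, _ => [::]
  end.

Fixpoint dotv (u v : seq N) : N :=
  match u, v with
  | x :: u', y :: v' => BinNat.N.add (BinNat.N.mul x y) (dotv u' v')
  | _, _ => N0
  end.

Definition shiftl (s : seq N) : seq N :=
  if s is x :: s' then rcons s' x else [::].

Definition shiftr (s : seq N) : seq N :=
  if s is x :: s' then last x s' :: belast x s' else [::].

(** Cyclic convolution of [P] with the indicator [A] when [shift] is [shiftr], and cyclic
    correlation when it is [shiftl]. *)
Fixpoint convv (shift : seq N -> seq N) (A : seq bool) (P : seq N) : seq N :=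
  match A with
  | [::] => [seq N0 | _ <- P]
  | a :: A' =>
    let r := convv shift A' (shift P) in if a then addv P r else r
  end.

(* The pair (P, Q) lists the numbers of walks from (0, false) to the vertices
   (x, false) and (x, true) of the bicirculant graph coded by u. *)
Definition stepv (u : seq bool * seq bool) (M : seq N * seq N) :
    seq N * seq N :=
  let: (P, Q) := M in
  (addv (convv shiftr u.1 P) (convv shiftl u.2 Q),
   addv (convv shiftr u.2 P) (convv shiftr u.1 Q)).

Definition startv (p : nat) : seq N * seq N :=
  (Npos xH :: nseq p.-1 N0, nseq p N0).

Definition dotM (M M' : seq N * seq N) : N :=
  BinNat.N.add (dotv M.1 M'.1) (dotv M.2 M'.2).

Variable n : nat.
Local Notation p := n.+2.

Definition vec (P : seq N) (x : 'I_p) : nat := BinNat.N.to_nat (nth N0 P x).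
Definition pred_of_seq (s : seq bool) : pred 'I_p := fun x => nth false s x.

Lemma size_addv u v : size (addv u v) = minn (size u) (size v).
Proof.
by elim: u v => [|x u IHu] [|y v]; rewrite /= ?minn0 ?min0n ?minnSS ?IHu.
Qed.

Lemma size_shiftl s : size (shiftl s) = size s.
Proof. by case: s => //= x s; rewrite size_rcons. Qed.

Lemma size_shiftr s : size (shiftr s) = size s.
Proof. by case: s => //= x s; rewrite size_belast. Qed.

Lemma vec_addv u v x : size u = p -> size v = p ->
  vec (addv u v) x = vec u x + vec v x.
Proof.
move=> szu szv; rewrite /vec; have : x < size u by rewrite szu.
have : size u = size v by rewrite szu.
move: (nat_of_ord x) => i {x szu szv}.
elim: u v i => [|a u IHu] [|b v] [|i] //= [eq_sz] lt_i.
  by rewrite Nnat.N2Nat.inj_add.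
exact: IHu.
Qed.

Lemma to_nat_dotv u v : size u = p -> size v = p ->
  BinNat.N.to_nat (dotv u v) = \sum_(x < p) vec u x * vec v x.
Proof.
move=> szu szv.
pose F u v i := BinNat.N.to_nat (nth N0 u i) * BinNat.N.to_nat (nth N0 v i).
transitivity (\sum_(x < size u) F u v x); last by rewrite szu.
have {szv} : size u = size v by rewrite szu.
elim: u v {szu} => [|a u IHu] [|b v] //= => [_|[eq_sz]]; first by rewrite big_ord0.
rewrite Nnat.N2Nat.inj_add Nnat.N2Nat.inj_mul big_ord_recl /=.
by rewrite (IHu v).
Qed.

Lemma vec_shiftl P x : size P = p -> vec (shiftl P) x = vec P (x + 1)%R.
Proof.
case: P => // a P [szP]; rewrite /vec; congr BinNat.N.to_nat.
have -> : nat_of_ord (x + 1)%R = x.+1 %% p by rewrite -[x.+1]addn1.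
rewrite /shiftl nth_rcons szP; have := ltn_ord x.
rewrite ltnS leq_eqVlt => /predU1P[-> | lt_x]; first by rewrite ltnn eqxx modnn.
by rewrite lt_x modn_small.
Qed.

(** The left shift undoes the right one, so the previous lemma applies. *)
Lemma vec_shiftr P x : size P = p -> vec (shiftr P) x = vec P (x - 1)%R.
Proof.
move=> szP; rewrite -[in LHS](subrK 1%R x) -vec_shiftl ?size_shiftr //.
by congr (vec _ _); case: P szP => // a P _; rewrite /= -lastI.
Qed.

(** Leaving [d] general lets one induction serve both [shiftr] (d = -1) and [shiftl] (d = 1). *)
Lemma vec_convv shift (d : 'I_p) A P :
    (forall Q, size (shift Q) = size Q) ->
    (forall Q x, size Q = p -> vec (shift Q) x = vec Q (x + d)%R) ->
    size P = p ->
  size (convv shift A P) = p /\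
  forall x, vec (convv shift A P) x
            = \sum_(i < size A) nth false A i * vec P (x + d *+ i)%R.
Proof.
move=> sz_sh vec_sh; elim: A P => [|a A IHA] P szP /=.
  split=> [|x]; first by rewrite size_map.
  by rewrite big_ord0 /vec (nth_map N0) // szP.
have [sz_r vec_r] := IHA (shift P) (etrans (sz_sh P) szP).
have sum_r x : vec (convv shift A (shift P)) x
    = \sum_(i < size A) nth false A i * vec P (x + d *+ i.+1)%R.
  by rewrite vec_r; apply: eq_bigr => i _; rewrite vec_sh // mulrSr addrA.
split=> [|x]; first by case: a; rewrite // size_addv szP sz_r minnn.
rewrite big_ord_recl /= mulr0n addr0; case: a => /=; last by rewrite mul0n sum_r.
by rewrite mul1n vec_addv // sum_r.
Qed.

Lemma vec_conv_shiftr A P : size A = p -> size P = p ->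
  size (convv shiftr A P) = p /\
  forall x, vec (convv shiftr A P) x
            = \sum_z vec P z * pred_of_seq A (x - z)%R.
Proof.
move=> szA szP.
have [-> vecE] := vec_convv A size_shiftr (fun Q x => @vec_shiftr Q x) szP.
split=> // x; rewrite vecE szA (reindex_inj (inv_inj (subKr x))).
apply: eq_bigr => z _; rewrite mulnC mulNrn.
by rewrite natr_Zp subKr.
Qed.

Lemma vec_conv_shiftl A P : size A = p -> size P = p ->
  size (convv shiftl A P) = p /\
  forall x, vec (convv shiftl A P) x
            = \sum_z vec P z * pred_of_seq A (z - x)%R.
Proof.
move=> szA szP.
have [-> vecE] := vec_convv A size_shiftl (fun Q x => @vec_shiftl Q x) szP.
split=> // x; rewrite vecE szA (reindex_inj (addIr (- x)%R)).
apply: eq_bigr => z _; rewrite mulnC.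
by rewrite natr_Zp addrC subrK.
Qed.

Lemma sum_prod_bool (F : 'I_p * bool -> nat) :
  \sum_w F w = \sum_z F (z, false) + \sum_z F (z, true).
Proof.
rewrite (eq_bigr (fun w => F (w.1, w.2))); last by case.
rewrite -(pair_bigA _ (fun z e => F (z, e))) -big_split.
by apply: eq_bigr => z _; rewrite big_bool /= addnC.
Qed.

Section Soundness.

Variables u : seq bool * seq bool.
Hypotheses (szA : size u.1 = p) (szB : size u.2 = p).
Hypothesis cA : circulant_set (pred_of_seq u.1).
Local Notation X := (bicirculant (pred_of_seq u.1) (pred_of_seq u.2)).

(** A step from [false] to [true] reads [B] at the new minus the old position, a step back at the
    old minus the new: hence a convolution one way and a correlation the other. Within a copy the
    direction is immaterial as [A] is symmetric. *)
Lemma walk_vectors k (M := iter k (stepv u) (startv p)) :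
  [/\ size M.1 = p, size M.2 = p
    & forall x, vec M.1 x = walks X k (0%R, false) (x, false) /\
                vec M.2 x = walks X k (0%R, false) (x, true)].
Proof.
have nth0 m i : nth N0 (nseq m N0) i = N0 by rewrite nth_nseq if_same.
rewrite {}/M; elim: k => [|k].
  split=> [||x]; [by rewrite /= size_nseq | by rewrite size_nseq |].
  rewrite /vec; split; last by rewrite [nth _ _ _]nth0 /= xpair_eqE andbF.
  rewrite [RHS]/= xpair_eqE andbT; case: x => [[|i] lt_i] //.
  by rewrite [nth _ _ _]nth0.
rewrite iterS; move: (iter k _ _) => [P Q] [/= szP szQ vecM].
have [sz1 vec1] := vec_conv_shiftr szA szP.
have [sz2 vec2] := vec_conv_shiftl szB szQ.
have [sz3 vec3] := vec_conv_shiftr szB szP.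
have [sz4 vec4] := vec_conv_shiftr szA szQ.
have walksS v : \sum_w walks X k (0%R, false) w * X w v
    = \sum_z vec P z * X (z, false) v + \sum_z vec Q z * X (z, true) v.
  by rewrite sum_prod_bool; congr (_ + _); apply: eq_bigr => z _;
    have [vP vQ] := vecM z; rewrite ?vP ?vQ.
have AN x y : pred_of_seq u.1 (x - y)%R = pred_of_seq u.1 (y - x)%R.
  by rewrite -(proj2 cA) opprB.
split; rewrite ?size_addv ?sz1 ?sz2 ?sz3 ?sz4 ?minnn // => x.
rewrite !vec_addv // vec1 vec2 vec3 vec4 !walksS /bicirculant /=.
by split; congr (_ + _); apply: eq_bigr => z _; rewrite // AN.
Qed.

(** A closed walk is cut at its [i]-th vertex and its second half is reversed, which symmetry of the
    graph permits. *)
Lemma dotM_walks i j :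
  BinNat.N.to_nat (dotM (iter i (stepv u) (startv p)) (iter j (stepv u) (startv p)))
  = walks X (i + j) (0%R, false) (0%R, false).
Proof.
have [szi1 szi2 veci] := walk_vectors i; have [szj1 szj2 vecj] := walk_vectors j.
rewrite /dotM Nnat.N2Nat.inj_add !to_nat_dotv // walksD sum_prod_bool.
have symX := bicirculant_sym (pred_of_seq u.2) cA.
congr (_ + _); apply: eq_bigr => z _; have [vi wi] := veci z;
  by have [vj wj] := vecj z; rewrite ?vi ?wi ?vj ?wj (walks_sym j (0%R, false) _ symX).
Qed.

End Soundness.
End WalkVectors.

(** * Affine normal forms and their separation by closed walks *)

Section Enumeration.

Import BinNums.

Fixpoint boolseqs (p : nat) : seq (seq bool) :=
  if p is p'.+1 then
    let l := boolseqs p' in [seq false :: s | s <- l] ++ [seq true :: s | s <- l]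
  else [:: [::]].

Definition circulantb (p : nat) (s : seq bool) : bool :=
  ~~ nth false s 0 &&
  all (fun i => nth false s (p - i) == nth false s i) (iota 1 p.-1).

Definition affine_image (p c d : nat) (s : seq bool) : seq bool :=
  [seq nth false s ((c * i + d) %% p) | i <- iota 0 p].

(** The strict lexicographic order with [false] below [true]. *)
Fixpoint lexb (s t : seq bool) : bool :=
  match s, t with
  | a :: s', b :: t' => if a then b && lexb s' t' else b || lexb s' t'
  | _, _ => false
  end.

Definition lex_minimal (p : nat) (s : seq bool) : bool :=
  ~~ has (fun c => has (fun d => lexb (affine_image p c d s) s) (iota 0 p))
         (iota 1 p.-1).

(** Only [B] is normalised. Affine maps fixing a minimal [B] may still move [A], so equivalent pairs
    can remain; [affine_equiv] recognises them. *)
Definition normal_pairs (p : nat) : seq (seq bool * seq bool) :=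
  [seq (A, B) | A <- filter (circulantb p) (boolseqs p),
                B <- filter (lex_minimal p) (boolseqs p)].

(** As in [bicirculant_affine], the multiplier is common to both sets and the translation acts on
    the second alone. *)
Definition affine_equiv (p : nat) (u v : seq bool * seq bool) : bool :=
  has (fun c => (affine_image p c 0 v.1 == u.1) &&
                has (fun d => affine_image p c d v.2 == u.2) (iota 0 p))
      (iota 1 p.-1).

Definition short_walks (p : nat) (u : seq bool * seq bool) : N * N * N :=
  let M1 := stepv u (startv p) in let M2 := stepv u M1 in
  let M3 := stepv u M2 in (dotM M1 M1, dotM M2 M3, dotM M3 M3).

Definition eq_short_walks (k k' : N * N * N) : bool :=
  [&& BinNat.N.eqb k.1.1 k'.1.1, BinNat.N.eqb k.1.2 k'.1.2
    & BinNat.N.eqb k.2 k'.2].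

Definition eq_long_walks (p : nat) (u v : seq bool * seq bool) : bool :=
  let M := iter 5 (stepv u) (startv p) in
  let M' := iter 5 (stepv v) (startv p) in
  BinNat.N.eqb (dotM M M) (dotM M' M') &&
  BinNat.N.eqb (dotM M (stepv u M)) (dotM M' (stepv v M')).

(* Closed walks of lengths 2, 5 and 6 separate almost all pairs; those of lengths
   10 and 11 are evaluated only for the few pairs that remain. Grouping by the
   degree d keeps the number of comparisons small. *)
Definition walks_classify (p : nat) : bool :=
  let l := [seq (short_walks p u, u) | u <- normal_pairs p] in
  all (fun d =>
    let ld := filter (fun ku => BinNat.N.eqb ku.1.1.1 d) l in
    all (fun ku => all (fun kv =>
      eq_short_walks ku.1 kv.1 ==>
      (affine_equiv p ku.2 kv.2 || ~~ eq_long_walks p ku.2 kv.2)) ld) ld)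
    [seq BinNat.N.of_nat d | d <- iota 0 p.*2.+1].

Lemma mem_boolseqs p s : size s = p -> s \in boolseqs p.
Proof.
elim: p s => [|p IHp] [|a s] //= [sz]; rewrite mem_cat.
by case: a; rewrite (map_f _ (IHp _ sz)) ?orbT.
Qed.

Fixpoint bincode (s : seq bool) : nat :=
  if s is a :: s' then a * 2 ^ size s' + bincode s' else 0.

Lemma bincode_lt s : bincode s < 2 ^ size s.
Proof.
elim: s => //= a s IHs; rewrite expnS mul2n -addnn.
by case: a; rewrite /= ?mul1n ?mul0n ?ltn_add2l // ltn_addr.
Qed.

Lemma lexb_bincode s t : size s = size t -> lexb s t -> bincode s < bincode t.
Proof.
elim: s t => [|a s IHs] [|b t] //= [sz]; rewrite sz.
case: a; case: b; rewrite //= ?ltn_add2l; try exact: IHs.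
by rewrite /= ?mul0n ?add0n mul1n ltn_addr // -sz bincode_lt.
Qed.

Variable n : nat.
Local Notation p := n.+2.
Hypothesis p_pr : prime p.

Lemma size_affine_image c d s : size (affine_image p c d s) = p.
Proof. by rewrite size_map size_iota. Qed.

Lemma mulr_ord_inj (c : 'I_p) : 0 < c -> injective ( *%R c).
Proof.
move=> c_gt0 x y /eqP; rewrite -subr_eq0 -mulrBr => /eqP eq0.
have : p %| c * (x - y)%R by rewrite /dvdn; apply/eqP; exact: (congr1 val eq0).
rewrite Euclid_dvdM // => /orP[]; first by rewrite gtnNdvd.
rewrite /dvdn [_ %% _]modn_small ?ltn_ord // => /eqP eq_xy.
by apply/eqP; rewrite -subr_eq0; apply/eqP/val_inj.
Qed.

Lemma affine_imageE (c d : 'I_p) s :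
  pred_of_seq (affine_image p c d s) =1 (fun x : 'I_p => pred_of_seq s (c * x + d)%R).
Proof.
move=> x; rewrite /pred_of_seq (nth_map 0) ?size_iota // nth_iota // add0n.
by rewrite /= modnDml.
Qed.

Local Notation X u := (bicirculant (@pred_of_seq n u.1) (@pred_of_seq n u.2)).

Lemma affine_image_isom c d (u : seq bool * seq bool) :
    c \in iota 1 n.+1 -> d \in iota 0 p ->
  graph_isom (X (affine_image p c 0 u.1, affine_image p c d u.2)) (X u).
Proof.
rewrite !mem_iota add1n add0n => /andP[c_gt0 c_lt] /andP[_ d_lt].
have := bicirculant_affine (pred_of_seq u.1) (pred_of_seq u.2) (Ordinal d_lt)
  (@mulr_ord_inj (Ordinal c_lt) c_gt0).
apply: graph_isom_trans; apply/eq_graph_isom/eq_bicirculant => x /=.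
  by rewrite (affine_imageE (Ordinal c_lt) 0%R) addr0.
by rewrite (affine_imageE (Ordinal c_lt) (Ordinal d_lt)).
Qed.

Lemma circulant_affine_image c s : c \in iota 1 n.+1 ->
    circulant_set (@pred_of_seq n s) ->
  circulant_set (@pred_of_seq n (affine_image p c 0 s)).
Proof.
rewrite mem_iota add1n => /andP[c_gt0 c_lt] [s0 sN].
have E := affine_imageE (Ordinal c_lt) 0%R s.
by split=> [|x]; rewrite !E !addr0 ?mulr0 // mulrN sN.
Qed.

Lemma circulant_setb s : circulant_set (@pred_of_seq n s) -> circulantb p s.
Proof.
case=> s0 sN; apply/andP; split; first exact: negbT s0.
apply/allP => i; rewrite mem_iota add1n => /andP[i_gt0 i_lt]; apply/eqP.
have := sN (Ordinal i_lt); rewrite /pred_of_seq /= modn_small //.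
by rewrite ltn_subrL i_gt0.
Qed.

(** Descent: while some affine image of [B] is lexicographically smaller, pass to it. The value of
    [B] as a binary number, [bincode], strictly decreases. *)
Lemma normal_pair_isom (u : seq bool * seq bool) :
    size u.1 = p -> size u.2 = p -> circulant_set (@pred_of_seq n u.1) ->
  exists2 v, v \in normal_pairs p & [/\ size v.1 = p, size v.2 = p,
    circulant_set (@pred_of_seq n v.1) & graph_isom (X v) (X u)].
Proof.
have [k] := ubnP (bincode u.2); elim: k u => // k IHk [A B] /= lt_k szA szB cA.
have [minB | ] := boolP (lex_minimal p B).
  exists (A, B); last by split=> //; apply: eq_graph_isom.
  by apply/allpairsP; exists (A, B); split; rewrite // mem_filter
    ?minB ?circulant_setb ?mem_boolseqs.
rewrite negbK => /hasP[c c_in /hasP[d d_in lt_B]].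
have [||||v v_in [szv1 szv2 cv isov]] :=
  IHk (affine_image p c 0 A, affine_image p c d B); rewrite ?size_affine_image //.
- apply: leq_trans (lexb_bincode _ lt_B) _; last by rewrite -ltnS.
  by rewrite size_affine_image szB.
- exact: circulant_affine_image.
exists v => //; split=> //; apply: graph_isom_trans isov _.
exact: (affine_image_isom (A, B)).
Qed.

(** Both graphs are replaced by normal forms. These agree on all closed walks, so the check compares
    them and can only report affine equivalence, which gives an isomorphism. *)
Lemma walks_classify_isom (A B A' B' : pred 'I_p) :
    walks_classify p -> circulant_set A -> circulant_set A' ->
    (forall k, closed_walks (bicirculant A B) k
               = closed_walks (bicirculant A' B') k) ->
  graph_isom (bicirculant A B) (bicirculant A' B').
Proof.
move=> chk cA cA' eq_cl.
have to_seq (C : pred 'I_p) : exists2 s, size s = p & C =1 pred_of_seq s.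
  exists [seq C x | x <- enum 'I_p]; first by rewrite size_map size_enum_ord.
  by move=> x; rewrite /pred_of_seq (nth_map 0%R) ?size_enum_ord // nth_ord_enum.
have normalize (C D : pred 'I_p) : circulant_set C -> exists2 v, v \in normal_pairs p &
    [/\ size v.1 = p, size v.2 = p, circulant_set (@pred_of_seq n v.1)
      & graph_isom (X v) (bicirculant C D)].
  have [s szs Cs] := to_seq C; have [t szt Dt] := to_seq D => - [C0 CN].
  have [||| v v_in [? ? ? isov]] := @normal_pair_isom (s, t) => //.
    by split=> [|x]; rewrite -!Cs.
  exists v => //; split=> //; apply: graph_isom_trans isov _.
  by apply/eq_graph_isom/eq_bicirculant => x; rewrite ?Cs ?Dt.
have [u u_in [szu1 szu2 cu isou]] := normalize A B cA.
have [v v_in [szv1 szv2 cv isov]] := normalize A' B' cA'.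
suff isouv : graph_isom (X u) (X v).
  exact: graph_isom_trans (graph_isom_sym isou) (graph_isom_trans isouv isov).
have eq_walks i j :
    dotM (iter i (stepv u) (startv p)) (iter j (stepv u) (startv p))
    = dotM (iter i (stepv v) (startv p)) (iter j (stepv v) (startv p)).
  apply: Nnat.N2Nat.inj; rewrite !dotM_walks //.
  (* By vertex-transitivity, the closed walks at one vertex are those of the whole graph divided by
     2p. *)
  apply/eqP; rewrite -(eqn_pmul2l (isT : 0 < p.*2)).
  rewrite -!bicirculant_closed_walks //; apply/eqP.
  have [h bh eh] := isou; have [g bg eg] := isov.
  by rewrite -(closed_walks_isom bh eh) -(closed_walks_isom bg eg).
have N_eqbxx x : BinNat.N.eqb x x by apply/BinNat.N.eqb_eq.
have eq_short : short_walks p u = short_walks p v.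
  rewrite /short_walks; congr (_, _, _).
  - exact: (eq_walks 1 1).
  - exact: (eq_walks 2 3).
  - exact: (eq_walks 3 3).
have eq_long : eq_long_walks p u v.
  rewrite /eq_long_walks (eq_walks 5 5).
  by rewrite (eq_walks 5 6 : dotM _ (stepv _ _) = _) !N_eqbxx.
(* Closed walks of length 2 at a vertex count its neighbours; there are at most 2p vertices, so this
   degree is among those listed in the check. *)
pose d := (short_walks p u).1.1.
have d_le : BinNat.N.to_nat d < p.*2.+1.
  rewrite (dotM_walks szu1 szu2 cu 1 1) walksD ltnS.
  apply: (@leq_trans (\sum_(z : 'I_p * bool) 1)).
    apply: leq_sum => z _; rewrite !walks1.
    by rewrite -[1]/(1 * 1); apply: leq_mul; apply: leq_b1.
  by rewrite sum1_card card_prod card_ord card_bool muln2.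
have d_in : d \in [seq BinNat.N.of_nat d | d <- iota 0 p.*2.+1].
  by rewrite -[d]Nnat.N2Nat.id map_f // mem_iota.
have in_bucket w : w \in normal_pairs p -> short_walks p w = short_walks p u ->
    (short_walks p w, w) \in [seq ku <- [seq (short_walks p u, u) | u <- normal_pairs p]
                             | BinNat.N.eqb ku.1.1.1 d].
  move=> w_in eqw; rewrite mem_filter (map_f (fun u => (short_walks p u, u))) //.
  by rewrite andbT /d -eqw; apply: N_eqbxx.
move/allP/(_ d d_in)/allP/(_ _ (in_bucket u u_in erefl)): chk.
have eq_shortb : eq_short_walks (short_walks p u) (short_walks p v).
  by rewrite eq_short /eq_short_walks !N_eqbxx.
move/allP/(_ _ (in_bucket v v_in (esym eq_short)))/implyP/(_ eq_shortb).
(* The long walks agree, which leaves affine equivalence as the only alternative. *)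
rewrite eq_long orbF; case/hasP=> c c_in /andP[/eqP eq1 /hasP[e e_in /eqP eq2]].
have := affine_image_isom v c_in e_in.
by rewrite eq1 eq2.
Qed.

End Enumeration.

(* The computations are left to the lazy evaluation of the kernel, which, unlike
   the virtual machine, does not force both arguments of boolean connectives. *)
Lemma walks_classify_small p : p \in [:: 3; 5; 7] -> walks_classify p.
Proof. by rewrite !inE => /or3P[] /eqP->; exact_no_check (erefl true). Qed.

Lemma walks_classify11 : walks_classify 11.
Proof. exact_no_check (erefl true). Qed.

(** * Groups of order four *)

Section OrderFour.

(** A Cayley graph on Z/2 x Z/2: the booleans tell which of (1,0), (0,1), (1,1) lie in the
    connection set. *)
Definition klein_graph (a b0 b1 : bool) : rel ('I_2 * bool) :=
  bicirculant (@pred_of_seq 0 [:: false; a]) (@pred_of_seq 0 [:: b0; b1]).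

Lemma klein_graph_swap a b0 b1 :
  graph_isom (klein_graph a b0 b1) (klein_graph b0 a b1).
Proof.
pose h (u : 'I_2 * bool) : 'I_2 * bool := (inZp u.2, u.1 != 0%R).
have hK : involutive h.
  by case=> [[[|[|i]] lt_i] []]; rewrite /h //=; congr (_, _); apply: val_inj.
exists h; first exact: inv_bij.
by case: a; case: b0; case: b1; move=> [[[|[|i]] ?] []] [[[|[|j]] ?] []].
Qed.

Lemma klein_graph_shift a b0 b1 :
  graph_isom (klein_graph a b0 b1) (klein_graph a b1 b0).
Proof.
pose h (u : 'I_2 * bool) : 'I_2 * bool := (inZp (u.1 + u.2), u.2).
have hK : involutive h.
  by case=> [[[|[|i]] lt_i] []]; rewrite /h //=; congr (_, _); apply: val_inj.
exists h; first exact: inv_bij.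
by case: a; case: b0; case: b1; move=> [[[|[|i]] ?] []] [[[|[|j]] ?] []].
Qed.

(** The coordinate swap and the shear above generate all permutations of the three involutions, so
    only the size of the connection set matters. *)
Lemma klein_graph_isom (a b0 b1 a' b0' b1' : bool) :
    a + b0 + b1 = a' + b0' + b1' ->
  graph_isom (klein_graph a b0 b1) (klein_graph a' b0' b1').
Proof.
have sw := klein_graph_swap; have sh := klein_graph_shift.
have idK x y z : graph_isom (klein_graph x y z) (klein_graph x y z).
  exact: eq_graph_isom.
by case: a; case: b0; case: b1; case: a'; case: b0'; case: b1' => //= _;
  first [ exact: idK | exact: sw | exact: sh
        | exact: graph_isom_trans (sw _ _ _) (sh _ _ _)
        | exact: graph_isom_trans (sh _ _ _) (sw _ _ _) ].
Qed.

Lemma bicirculant2_isom (A B A' B' : pred 'I_2) :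
    circulant_set A -> circulant_set A' ->
    (forall k, closed_walks (@bicirculant 0 A B) k
               = closed_walks (@bicirculant 0 A' B') k) ->
  graph_isom (bicirculant A B) (bicirculant A' B').
Proof.
have toK (C D : pred 'I_2) : circulant_set C ->
    graph_isom (@klein_graph (C 1%R) (D 0%R) (D 1%R)) (bicirculant C D).
  move=> [C0 CN]; apply/eq_graph_isom/eq_bicirculant => [] [[|[|i]] lt_i] //.
  - by rewrite -C0; congr C; apply: val_inj.
  - by congr C; apply: val_inj.
  - by congr D; apply: val_inj.
  - by congr D; apply: val_inj.
(* Closed walks of length 2 determine the degree, hence the size of the connection set. *)
have degK (a b0 b1 : bool) :
    closed_walks (klein_graph a b0 b1) 2 = 4 * (a + b0 + b1).
  have cK : circulant_set (@pred_of_seq 0 [:: false; a]).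
    by split=> // [] [[|[|i]] lt_i].
  rewrite bicirculant_closed_walks //; congr (_ * _).
  rewrite -(@dotM_walks 0 ([:: false; a], [:: b0; b1]) erefl erefl cK 1 1).
  by case: a {cK}; case: b0; case: b1.
move=> cA cA' eq_cl; have isoA := toK A B cA; have isoA' := toK A' B' cA'.
apply: graph_isom_trans (graph_isom_sym isoA) (graph_isom_trans _ isoA').
apply: klein_graph_isom; apply/eqP; rewrite -(eqn_pmul2l (isT : 0 < 4)) -!degK.
have [h bh eh] := isoA; have [g bg eg] := isoA'.
by rewrite -(closed_walks_isom bh eh) -(closed_walks_isom bg eg) eq_cl.
Qed.

End OrderFour.

(** * From bicirculant graphs to the Cay-DS property *)

Section CayleyDS.

Lemma Cay_isom_bicirculant n (gT : finGroupType) (S : {set gT}) :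
    prime n.+2 -> #|gT| = n.+2.*2 -> connection_set S ->
  exists A B : pred 'I_n.+2,
    circulant_set A /\ graph_isom (Cay S) (bicirculant A B).
Proof.
move=> p_pr oG conS.
have [a [a' [b [oa a'P ba' bNa]]]] := order_2p_generators p_pr oG.
exists (@rot_part _ n a S), (@refl_part _ n a b S); split.
  exact: rot_part_circulant.
exact/graph_isom_sym/(Cay_bicirculant oa a'P).
Qed.

(** Closed walks of length 0 count the vertices, so the unknown second group also has order 2p and
    its Cayley graph is bicirculant as well. *)
Lemma Cay_DS_of_bicirculant n (gT : finGroupType) :
    prime n.+2 -> #|gT| = n.+2.*2 ->
    (forall A B A' B' : pred 'I_n.+2, circulant_set A -> circulant_set A' ->
      (forall k, closed_walks (bicirculant A B) k
                 = closed_walks (bicirculant A' B') k) ->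
      graph_isom (bicirculant A B) (bicirculant A' B')) ->
  Cay_DS gT.
Proof.
move=> p_pr oG classify S conS hT S' conS' cosp.
have symS := Cay_sym conS; have symS' := Cay_sym conS'.
have closed0 (T : finType) (e : rel T) : closed_walks e 0 = #|T|.
  by rewrite -sum1_card; apply: eq_bigr => x _; rewrite /= eqxx.
have oH : #|hT| = n.+2.*2.
  by rewrite -oG -(closed0 _ (Cay S)) ((cospectralP symS symS').1 cosp 0) closed0.
have [A [B [cA isoA]]] := Cay_isom_bicirculant p_pr oG conS.
have [A' [B' [cA' isoA']]] := Cay_isom_bicirculant p_pr oH conS'.
apply: (graph_isom_trans isoA (graph_isom_trans _ (graph_isom_sym isoA'))).
apply: classify => //; apply: (cospectral_isom _ _ _ _ isoA isoA').1 => //;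
  exact: bicirculant_sym.
Qed.

End CayleyDS.

(** * Homometric sets *)

Section CommonNeighbours.

Definition codegree (T : finType) (e : rel T) (u v : T) : nat :=
  \sum_w e u w * e v w.

(* An isomorphism invariant that is finer than the multiset of codegrees, which
   homometric sets do not separate. *)
Definition codegree_triangles (T : finType) (e : rel T) (y : T) : nat :=
  \sum_u e y u * (\sum_v e y v * (\sum_w e y w *
    (codegree e u v * codegree e v w * codegree e w u))).

Lemma codegree_triangles_isom (T U : finType) (e : rel T) (f : rel U) h :
    bijective h -> (forall x y, f (h x) (h y) = e x y) ->
  forall y, codegree_triangles f (h y) = codegree_triangles e y.
Proof.
move=> bij_h fh y.
have cd u v : codegree f (h u) (h v) = codegree e u v.
  rewrite /codegree (reindex h (onW_bij _ bij_h)).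
  by apply: eq_bigr => w _; rewrite !fh.
rewrite /codegree_triangles (reindex h (onW_bij _ bij_h)).
apply: eq_bigr => u _; rewrite fh (reindex h (onW_bij _ bij_h)).
congr (_ * _); apply: eq_bigr => v _.
rewrite fh (reindex h (onW_bij _ bij_h)).
by congr (_ * _); apply: eq_bigr => w _; rewrite fh !cd.
Qed.

End CommonNeighbours.

(** * Bipartite bicirculant graphs and autocorrelation *)

Section HaarGraphs.

Variable n : nat.
Local Notation p := n.+2.

Definition haar (s : seq 'I_p) : rel ('I_p * bool) :=
  bicirculant pred0 (fun x => x \in s).

Lemma pred0_circulant : circulant_set (pred0 : pred 'I_p).
Proof. by []. Qed.

Lemma haar_sym s : symmetric (haar s).
Proof. exact: bicirculant_sym. Qed.

Lemma haar_side (s : seq 'I_p) u v : haar s u v -> u.2 != v.2.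
Proof. by rewrite /haar /bicirculant; case: eqP. Qed.

Lemma walks_haar_parity s k u v :
  odd k != u.2 (+) v.2 -> walks (haar s) k u v = 0.
Proof.
elim: k v => [|k IHk] v /=.
  by have [->|//] := eqVneq u v; rewrite addbb.
move=> odd_k; apply: big1 => w _; case e_wv: (haar s w v); last by rewrite muln0.
have side := haar_side e_wv; rewrite IHk //; move: odd_k side.
by case: (odd k); case: (u.2); case: (v.2); case: (w.2).
Qed.

(** The autocorrelation of [s] at [d]. *)
Definition diff_reps (s : seq 'I_p) (d : 'I_p) : nat :=
  \sum_(c <- s) \sum_(b <- s) (b == c + d)%R.

Lemma sum_mem_seq (T : finType) (s : seq T) (F : T -> nat) : uniq s ->
  \sum_z (z \in s) * F z = \sum_(z <- s) F z.
Proof.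
move=> s_uniq; rewrite [RHS]big_uniq //= [RHS]big_mkcond /=.
by apply: eq_bigr => z _; case: (z \in s); rewrite ?mul1n ?mul0n.
Qed.

Lemma mem_sum_eq (T : eqType) (s : seq T) x : uniq s ->
  (x \in s) = \sum_(b <- s) (b == x) :> nat.
Proof.
move=> s_uniq; rewrite -count_uniq_mem // -sum1_count big_mkcond /=.
by apply: eq_bigr => b _; case: eqP.
Qed.

Lemma diff_repsE s d : uniq s ->
  \sum_z (z \in s) * ((z + d)%R \in s) = diff_reps s d.
Proof.
move=> s_uniq; rewrite sum_mem_seq //.
by apply: eq_bigr => c _; rewrite mem_sum_eq.
Qed.

Lemma diff_repsN s d : uniq s -> diff_reps s (- d)%R = diff_reps s d.
Proof.
move=> s_uniq; rewrite -!diff_repsE // (reindex_inj (addIr d)).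
by apply: eq_bigr => z _; rewrite addrK mulnC.
Qed.

(** Common neighbours on the other side correspond to pairs of elements of [s] with a prescribed
    difference. On the copy [false] its sign is reversed, which the evenness of the autocorrelation
    absorbs. *)
Lemma codegree_haar s u v : uniq s ->
  codegree (haar s) u v = (u.2 == v.2) * diff_reps s (v.1 - u.1)%R.
Proof.
move=> s_uniq; case: u => x e; case: v => y e'.
rewrite /codegree sum_prod_bool /haar /bicirculant.
case: e; case: e'; rewrite /= ?mul1n ?mul0n.
- rewrite [X in _ + X]big1 ?addn0 => [|z _]; last exact: mul0n.
  rewrite (reindex_inj (inv_inj (subKr x))) -diff_repsE //.
  apply: eq_bigr => z _; rewrite subKr; congr (_ * (_ \in s)).
  by rewrite opprB addrCA.
- by rewrite !big1 // => z _; exact: muln0.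
- by rewrite !big1 // => z _; exact: muln0.
- rewrite big1 ?add0n => [|z _]; last exact: mul0n.
  rewrite -diff_repsN // (reindex_inj (addIr x)) -diff_repsE //.
  by apply: eq_bigr => z _; rewrite addrK opprB addrA.
Qed.

Lemma walks2_haar s u v : walks (haar s) 2 u v = codegree (haar s) u v.
Proof.
rewrite (@walksD _ _ 1 1) /codegree; apply: eq_bigr => w _.
by rewrite !walks1 (haar_sym s w).
Qed.

Lemma perm_diff_reps s t d :
    perm_eq [seq (b - c)%R | c <- s, b <- s] [seq (b - c)%R | c <- t, b <- t] ->
  diff_reps s d = diff_reps t d.
Proof.
move=> homo; have reps r : diff_reps r d
    = \sum_(x <- [seq (b - c)%R | c <- r, b <- r]) (x == d).
  rewrite big_allpairs_dep; apply: eq_bigr => c _; apply: eq_bigr => b _.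
  by rewrite subr_eq addrC.
by rewrite !reps (perm_big _ homo).
Qed.

(* Homometric sets have the same autocorrelation, so the squares of the two
   adjacency matrices coincide, while odd powers have zero diagonal. *)
Lemma homometric_closed_walks s t : uniq s -> uniq t ->
    perm_eq [seq (b - c)%R | c <- s, b <- s] [seq (b - c)%R | c <- t, b <- t] ->
  forall k, closed_walks (haar s) k = closed_walks (haar t) k.
Proof.
move=> s_uniq t_uniq homo k.
have walks_even m u v : walks (haar s) m.*2 u v = walks (haar t) m.*2 u v.
  elim: m v => [|m IHm] v; first by [].
  rewrite doubleS -[m.*2.+2]addn2 !walksD; apply: eq_bigr => w _; rewrite IHm.
  by rewrite !walks2_haar !codegree_haar // (perm_diff_reps _ homo).
have [odd_k|even_k] := boolP (odd k).
  by rewrite /closed_walks !big1 // => x _; rewrite walks_haar_parity // odd_k addbb.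
apply: eq_bigr => x _; rewrite -[k]odd_double_half (negPf even_k) add0n.
exact: walks_even.
Qed.

Lemma codegree_triangles_haar s : uniq s ->
  codegree_triangles (haar s) (0%R, false) =
  \sum_(b <- s) \sum_(c <- s) \sum_(d <- s)
     (diff_reps s (c - b) * diff_reps s (d - c) * diff_reps s (b - d))%R.
Proof.
move=> s_uniq; have nbr F :
    \sum_u haar s (0%R, false) u * F u = \sum_(b <- s) F (b, true).
  rewrite sum_prod_bool /haar /bicirculant /=.
  rewrite big1 ?add0n => [|z _]; last by rewrite mul0n.
  rewrite -[RHS]sum_mem_seq //; apply: eq_bigr => z _.
  by rewrite subr0.
rewrite /codegree_triangles nbr; apply: eq_bigr => b _.
rewrite nbr; apply: eq_bigr => c _; rewrite nbr; apply: eq_bigr => d _.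
by rewrite !codegree_haar //= !mul1n.
Qed.

(** Autocorrelation at [c - b], written with sums to avoid subtraction. The relation [q] is
    congruence modulo p or plain equality, so that the two can be compared. *)
Definition nat_reps (q : rel nat) (s : seq nat) (b c : nat) : nat :=
  sumn [seq sumn [seq nat_of_bool (q (d' + b) (d + c)) | d' <- s] | d <- s].

Definition nat_triangles (q : rel nat) (s : seq nat) : nat :=
  sumn [seq sumn [seq sumn [seq
    nat_reps q s b c * nat_reps q s c d * nat_reps q s d b
    | d <- s] | c <- s] | b <- s].

Lemma nat_triangles_haar (s : seq nat) :
    uniq [seq (b%:R : 'I_p)%R | b <- s] ->
  codegree_triangles (haar [seq b%:R%R | b <- s]) (0%R, false) =
  nat_triangles (fun i j => i == j %[mod p]) s.
Proof.
move=> s_uniq; rewrite codegree_triangles_haar //.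
have reps b c : diff_reps [seq (b%:R : 'I_p)%R | b <- s] (c%:R - b%:R)%R
    = nat_reps (fun i j => i == j %[mod p]) s b c.
  rewrite /nat_reps sumnE big_map /diff_reps big_map; apply: eq_bigr => d _.
  rewrite sumnE !big_map; apply: eq_bigr => d' _.
  by rewrite addrA eq_sym subr_eq -!natrD eq_sym !Zp_nat.
rewrite /nat_triangles sumnE !big_map; apply: eq_bigr => b _.
rewrite sumnE !big_map; apply: eq_bigr => c _.
rewrite sumnE !big_map; apply: eq_bigr => d _.
by rewrite !reps.
Qed.

(** Sums of two elements do not wrap around modulo p, so the count no longer depends on p and one
    computation covers all large primes. *)
Lemma nat_triangles_small (s : seq nat) : all (fun b => b.*2 < p) s ->
  nat_triangles (fun i j => i == j %[mod p]) s = nat_triangles eq_op s.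
Proof.
move/allP=> small; have reps b c : b \in s -> c \in s ->
    nat_reps (fun i j => i == j %[mod p]) s b c = nat_reps eq_op s b c.
  move=> bs cs; congr sumn; apply/eq_in_map => d ds.
  congr sumn; apply/eq_in_map => d' ds'; congr nat_of_bool.
  have sum_small x y : x \in s -> y \in s -> x + y < p.
    move=> /small x_lt /small y_lt; have := leq_add x_lt (ltnW y_lt).
    by rewrite addSn -doubleD addnn ltn_double.
  by rewrite !modn_small ?sum_small.
congr sumn; apply/eq_in_map => b bs; congr sumn; apply/eq_in_map => c cs.
by congr sumn; apply/eq_in_map => d ds; rewrite !reps.
Qed.

Lemma natr_ord_uniq (s : seq nat) : uniq s -> all (fun b => b < p) s ->
  uniq [seq (b%:R : 'I_p)%R | b <- s].
Proof.
move=> s_uniq /allP s_lt; rewrite map_inj_in_uniq // => b c /s_lt b_lt /s_lt c_lt.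
by rewrite !Zp_nat => /(congr1 val) /=; rewrite !modn_small.
Qed.

(** Reduction from the integers to Z/p is additive, so it carries one difference multiset to the
    other. *)
Lemma int_homometric (s t : seq nat) :
    perm_eq [seq (b%:Z - c%:Z)%R | c <- s, b <- s]
            [seq (b%:Z - c%:Z)%R | c <- t, b <- t] ->
  perm_eq [seq (b - c : 'I_p)%R | c <- [seq b%:R%R | b <- s],
                                  b <- [seq b%:R%R | b <- s]]
          [seq (b - c : 'I_p)%R | c <- [seq b%:R%R | b <- t],
                                  b <- [seq b%:R%R | b <- t]].
Proof.
move/(perm_map (fun z : int => z%:~R%R : 'I_p)).
have castE r : [seq (b - c : 'I_p)%R | c <- [seq b%:R%R | b <- r],
                                       b <- [seq b%:R%R | b <- r]]
    = [seq (z%:~R : 'I_p)%R | z <- [seq (b%:Z - c%:Z)%R | c <- r, b <- r]].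
  rewrite map_allpairs allpairs_mapl allpairs_mapr.
  by apply/eq_in_allpairs => c b _ _; rewrite mulrzBr.
by rewrite !castE.
Qed.

End HaarGraphs.

(** * Haar graphs as dihedral Cayley graphs *)

Section Dihedral.

Local Open Scope group_scope.

Lemma card_dihedral_type q : 1 < q -> #|('D_(q.*2))%type| = q.*2.
Proof. by move=> q_gt1; rewrite -cardsT card_dihedral. Qed.

(** The presentation only bounds the order of [x]. Were [x] trivial, the group would have order at
    most 2; were [y] a power of [x], it would have order q. Both contradict the order 2q. *)
Lemma dihedral_generators q : prime q ->
  exists x y : ('D_(q.*2))%type,
    [/\ #[x] = q, y * x^-1 = x * y, y ^+ 2 = 1 & y \notin <[x]>].
Proof.
move=> q_pr; have q_gt1 := prime_gt1 q_pr; have q_gt0 := prime_gt0 q_pr.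
have oD := card_dihedral q_gt1.
have : [set: ('D_(q.*2))%type] \homg Grp (x : y : x ^+ q, y ^+ 2, x ^ y = x^-1).
  by rewrite -Grp_dihedral ?homg_refl.
case/existsP=> -[x y] /=; case/eqP=> defG xq y2 xy; exists x, y.
have x_neq1 : x != 1.
  apply: contraTneq isT => x1; move: defG oD; rewrite x1 cycle1 joing1G => <-.
  have : #[y] %| 2 by rewrite order_dvdn y2.
  move=> /dvdn_leq => /(_ isT); rewrite -orderE => y_le oy.
  by move: y_le; rewrite oy -[2]/(1.*2) leq_double leqNgt q_gt1.
have ox : #[x] = q.
  have : #[x] %| q by rewrite order_dvdn xq.
  by move: q_pr => /primeP[_ dv] /dv; rewrite order_eq1 (negPf x_neq1) => /eqP.
split=> //.
  by rewrite -xy conjgE mulKVg.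
apply/negP => yx; move: defG; rewrite (joing_idPl _) ?cycle_subG // => defG.
move: oD; rewrite -defG -orderE ox -addnn => /eqP.
by rewrite -{1}[q]addn0 eqn_add2l eq_sym -leqn0 leqNgt q_gt0.
Qed.

Section HaarCayley.

Variables (gT : finGroupType) (n : nat) (a b : gT).
Local Notation p := n.+2.
Hypotheses (oa : #[a] = p) (ba : b * a^-1 = a * b) (b2 : b ^+ 2 = 1).
Hypotheses (bNa : b \notin <[a]>) (oG : #|gT| = p.*2).

Definition refl_set (s : seq 'I_p) : {set gT} := [set a ^+ (z : 'I_p) * b | z in s].

Let reflV (z : nat) : (a ^+ z * b)^-1 = a ^+ z * b.
Proof.
have bV : b^-1 = b by apply: (mulgI b); rewrite mulgV -b2.
rewrite invMg bV; elim: z => [|z IHz]; first by rewrite invg1 mulg1 mul1g.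
by rewrite [in LHS]expgS invMg mulgA IHz -mulgA ba mulgA -expgSr.
Qed.

(** Reflections are involutions, so any set of them is closed under inversion and [s] is
    unconstrained. *)
Lemma refl_set_connection s : connection_set (refl_set s).
Proof.
split.
  apply/imsetP => -[z _ def1].
  by move: bNa; rewrite -(groupMl b (mem_cycle a z)) -def1 group1.
apply/setP => g; rewrite inE; apply/imsetP/imsetP => -[z zs def_g]; exists z => //.
  by rewrite -reflV -def_g invgK.
by rewrite def_g reflV.
Qed.

Lemma refl_set_card s : uniq s -> #|refl_set s| = size s.
Proof.
move=> s_uniq; rewrite card_imset ?(card_uniqP s_uniq) // => x y /mulIg/eqP.
by rewrite eq_expg_mod_order oa !modn_small // => /eqP/val_inj.
Qed.

Lemma Cay_regular (S : {set gT}) : regular_graph #|S| (Cay S).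
Proof.
move=> x; have inj : injective (fun y => x * y^-1) by move=> y z /mulgI/invg_inj.
by rewrite -(card_preimset S inj); apply: eq_card => y; rewrite !inE.
Qed.

Lemma Cay_refl_set_isom s : graph_isom (Cay (refl_set s)) (haar s).
Proof.
apply/graph_isom_sym.
have iso := Cay_bicirculant oa (or_intror erefl) ba bNa oG (refl_set_connection s).
apply: graph_isom_trans iso; apply/eq_graph_isom/eq_bicirculant => x.
  apply/esym/negP; rewrite /rot_part => /imsetP[z _ def_x].
  by move: bNa; rewrite -(groupMl b (mem_cycle a z)) -def_x mem_cycle.
rewrite /refl_part; apply/idP/imsetP => [xs | [z zs /mulIg/eqP]]; first by exists x.
by rewrite eq_expg_mod_order oa !modn_small // => /eqP/val_inj->.
Qed.

End HaarCayley.

End Dihedral.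

(** Homometry is required only modulo p, which admits pairs that are not homometric over the
    integers. *)
Lemma homometric_Cay n k (s t : seq nat) (sI := [seq (b%:R : 'I_n.+2)%R | b <- s])
    (tI := [seq (b%:R : 'I_n.+2)%R | b <- t]) :
    prime n.+2 -> uniq sI -> uniq tI -> size s = k -> size t = k ->
    perm_eq [seq (b - c)%R | c <- sI, b <- sI] [seq (b - c)%R | c <- tI, b <- tI] ->
    nat_triangles (fun i j => i == j %[mod n.+2]) s
      != nat_triangles (fun i j => i == j %[mod n.+2]) t ->
  exists S T : {set ('D_(2 * n.+2))%type},
     [/\ connection_set S, connection_set T,
         regular_graph k (Cay S) /\ regular_graph k (Cay T),
         cospectral (Cay S) (Cay T)
       & ~ graph_isom (Cay S) (Cay T)].
Proof.
move=> p_pr s_uniq t_uniq sz_s sz_t homo; rewrite mul2n => neq_tri.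
have oG := card_dihedral_type (prime_gt1 p_pr).
have [x [y [ox yx y2 yNx]]] := dihedral_generators p_pr.
have conS := refl_set_connection yx y2 yNx.
have isoS := Cay_refl_set_isom ox yx y2 yNx oG.
exists (refl_set x y sI), (refl_set x y tI); split=> //.
- have := refl_set_card y ox s_uniq; have := refl_set_card y ox t_uniq.
  rewrite !size_map sz_s sz_t => oT oS.
  by split; [rewrite -oS | rewrite -oT]; apply: Cay_regular.
- apply: (cospectral_isom _ _ _ _ (isoS sI) (isoS tI)).2; try exact: Cay_sym;
    try exact: haar_sym.
  exact: homometric_closed_walks.
move=> isoST.
have [h bij_h eh] : graph_isom (haar sI) (haar tI).
  apply: graph_isom_trans (graph_isom_sym (isoS sI)) _.
  exact: graph_isom_trans isoST (isoS tI).
(* The isomorphism may move the base vertex; an automorphism of the target brings its image back, so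
   the invariants at [(0, false)] can be compared. *)
have [g bij_g [g0 eg]] :=
  bicirculant_transitive (fun z => z \in tI) (h (0%R, false)) (pred0_circulant n).
move/eqP: neq_tri; apply.
rewrite -!nat_triangles_haar //.
rewrite -(codegree_triangles_isom bij_h eh) -g0.
exact: (codegree_triangles_isom bij_g eg).
Qed.

Lemma cospectral_nonisomorphic p : prime p -> 13 <= p ->
  exists S T : {set ('D_(2 * p))%type},
     [/\ connection_set S, connection_set T,
         regular_graph 6 (Cay S) /\ regular_graph 6 (Cay T),
         cospectral (Cay S) (Cay T)
       & ~ graph_isom (Cay S) (Cay T)].
Proof.
case: p => [|[|n]] // p_pr p_ge.
(* Modulo 19 the invariant codegree_triangles fails to separate the generic pair. *)
have [p19 | p_neq19] := eqVneq n.+2 19.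
  case: p19 p_pr {p_ge} => -> p_pr.
  (* These sets are homometric modulo 19 but not over the integers, where their largest differences
     are 10 and 11. *)
  by apply: (@homometric_Cay 17 6 [:: 0; 1; 2; 3; 6; 10] [:: 0; 1; 2; 4; 5; 11]).
apply: (@homometric_Cay n 6 [:: 0; 1; 2; 6; 8; 11] [:: 0; 1; 6; 7; 9; 11]) => //.
- by apply: natr_ord_uniq => //=; rewrite !(leq_trans _ p_ge).
- by apply: natr_ord_uniq => //=; rewrite !(leq_trans _ p_ge).
- exact: int_homometric.
(* The largest element is 11, so from 23 on no sum of two elements wraps around; the smaller primes
   13 and 17 are computed directly. *)
have [p_ge23 | p_lt23] := leqP 23 n.+2.
  by rewrite !nat_triangles_small; [vm_compute | |];
    rewrite //= !(leq_trans _ p_ge23).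
have : n.+2 \in [:: 13; 17].
  move: p_pr p_ge p_neq19 p_lt23; clear.
  by do 23![case: n => [|n] //].
by rewrite !inE => /orP[] /eqP[->]; vm_compute.
Qed.

Unset Implicit Arguments.

Theorem theorem1p3 (p : nat) (p_pr : prime p) :
  (Cay_DS ('D_(2 * p))%type <-> p \in [:: 2; 3; 5; 7; 11]) /\
  (13 <= p ->
   exists S T : {set ('D_(2 * p))%type},
     [/\ connection_set S, connection_set T,
         regular_graph 6 (Cay S) /\ regular_graph 6 (Cay T),
         cospectral (Cay S) (Cay T)
       & ~ graph_isom (Cay S) (Cay T)]).
Proof.
split; last exact: cospectral_nonisomorphic.
split=> [DS | p_in].
  have [p_lt | p_ge] := ltnP p 13.
    (* The listed primes are all those below 13. *)
    by move: p_pr p_lt {DS}; do 13![case: p => [|p] //].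
  have [S [T [conS conT _ cosp niso]]] := cospectral_nonisomorphic p_pr p_ge.
  by case: niso; apply: DS.
have oG : #|('D_(2 * p))%type| = p.*2.
  by rewrite mul2n card_dihedral_type ?prime_gt1.
case: p p_pr p_in oG => [|[|n]] // p_pr p_in oG.
apply: (Cay_DS_of_bicirculant p_pr oG) => A B A' B'.
move: p_in; rewrite inE => /predU1P[n0 | p_in].
  by case: n0 A B A' B' => -> A B A' B'; apply: bicirculant2_isom.
apply: walks_classify_isom => //.
have /orP[p_in3 | /eqP->] : (n.+2 \in [:: 3; 5; 7]) || (n.+2 == 11).
- by move: p_in; rewrite !inE -!orbA.
- exact: walks_classify_small.
exact: walks_classify11.
Qed.
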